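(* Let $X$ be a real Banach space with norm $\|\cdot\|$, let $C^0([0,1];X)$ be the space of continuous mappings from $[0,1]$ to $X$, and let $\Phi:X\to\mathbb{R}$ be a locally Lipschitz functional. For $z_0,z_1\in X$ define $$\Gamma:=\{c\in C^0([0,1];X): c(0)=z_0,\ c(1)=z_1\},\qquad \gamma:=\inf_{c\in\Gamma}\max_{0\le t\le 1}\Phi(c(t)),$$ and set $\Phi_\gamma:=\{x\in X:\Phi(x)\ge\gamma\}$. If $F\subset X$ is a closed subset such that $F\cap\Phi_\gamma$ separates $z_0$ and $z_1$, then there exists a sequence $\{x_n\}\subset X$ such that $$\mathrm{dist}_\delta(x_n,F)\to 0,\qquad \Phi(x_n)\to\gamma,\qquad (1+\|x_n\|)\min_{y^*\in\partial\Phi(x_n)}\|y^*\|\to 0 .$$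
   Context: For a locally Lipschitz $\Phi:X\to\mathbb{R}$, the generalized directional derivative at $x$ along $v$ is $\Phi^0(x,v):=\limsup_{w\to x,\ t\downarrow 0}\frac{\Phi(w+tv)-\Phi(w)}{t}$, and the Clarke generalized gradient is $\partial\Phi(x):=\{x^*\in X^*:\langle x^*,v\rangle\le\Phi^0(x,v)\ \forall v\in X\}$; $\|y^*\|$ for $y^*\in X^*$ is the dual norm. The $\delta$-distance on $X$ is $\delta(x_1,x_2):=\inf\{l(c): c\in C^1([0,1],X),\ c(0)=x_1,\ c(1)=x_2\}$ with $l(c):=\int_0^1\frac{\|\dot c(t)\|}{1+\|c(t)\|}\,dt$, and $\mathrm{dist}_\delta(x,F):=\inf\{\delta(x,y):y\in F\}$. A closed set $H\subset X$ separates $z_0$ and $z_1$ if $z_0,z_1\in X\setminus H$ lie in different connected components of $X\setminus H$ (equivalently, $X\setminus H=\Omega_0\cup\Omega_1$ with $\Omega_0,\Omega_1$ disjoint open sets, $z_0\in\Omega_0$, $z_1\in\Omega_1$). *)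

(* Defs.v *)
From HB Require Import structures.
From mathcomp Require Import all_boot all_order all_algebra.
From mathcomp Require Import all_classical all_reals all_analysis.

Set Implicit Arguments.
Unset Strict Implicit.
Unset Printing Implicit Defensive.

Import Order.TTheory GRing.Theory Num.Theory.
Import numFieldNormedType.Exports.

Local Open Scope classical_set_scope.
Local Open Scope ring_scope.

Definition is_maximum (R : realType) (A : set R) (m : R) := A m /\ ubound A m.
Definition is_minimum (R : realType) (A : set R) (m : R) := A m /\ lbound A m.

Section clarke.
Context {R : realType} {X : normedModType R}.
Implicit Types (Phi : X -> R) (x v : X).

Definition locally_lipschitz Phi :=
  forall x, exists2 U, nbhs x U & [lipschitz (Phi y : R^o) | y in U].

(* Extended-real valued, so that it is meaningful for every Phi; it is finite
   when Phi is locally Lipschitz. *)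
Definition clarke_derivative Phi x v : \bar R :=
  limf_esup (fun wt : X * R => ((Phi (wt.1 + wt.2 *: v) - Phi wt.1) / wt.2)%:E)
    (filter_prod (nbhs x) (0 : R)^'+).

(* The topological dual of X is the set of continuous y : {linear X -> R^o}. *)
Definition dual_norm (y : {linear X -> R^o}) : R :=
  sup [set `|y v| | v in [set v : X | `|v| <= 1]].

Definition clarke_gradient Phi x : set {linear X -> R^o} :=
  [set y | continuous y /\
           forall v, ((y v : R)%:E <= clarke_derivative Phi x v)%E].

End clarke.

Section delta_distance.
Context {R : realType} {X : normedModType R}.
Implicit Types (c : R -> X) (x : X) (F : set X).

(* A curve on [0, 1] is represented by a function on R of which only the values
   on [0, 1] matter; differentiation is relative to [0, 1], hence one-sided at
   the endpoints. *)
Definition difference_quotient c (t s : R) : X := (s - t)^-1 *: (c s - c t).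

Definition derivable01 c (t : R) :=
  cvg (difference_quotient c t s @[s --> within `[0, 1] t^']).

Definition derive01 c (t : R) : X :=
  lim (difference_quotient c t s @[s --> within `[0, 1] t^']).

Definition C1_curve c :=
  {in `[0, 1], forall t, derivable01 c t} /\
  {within `[0, 1], continuous (derive01 c)}.

Definition delta_length c : R :=
  \int[@lebesgue_measure R]_(t in `[0, 1]) (`|derive01 c t| / (1 + `|c t|)).

Definition delta x1 x2 : R :=
  inf [set delta_length c |
        c in [set c | [/\ C1_curve c, c 0 = x1 & c 1 = x2]]].

(* [inf set0 = 0] in the library: meaningful for nonempty F only. *)
Definition dist_delta x F : R := inf [set delta x y | y in F].

End delta_distance.

Section minimax.
Context {R : realType} {X : normedModType R}.
Implicit Types (Phi : X -> R) (z : X) (H : set X).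

Definition paths z0 z1 : set (R -> X) :=
  [set c : R -> X | [/\ {within `[0, 1], continuous c}, c 0 = z0 & c 1 = z1]].

Definition minimax_level Phi z0 z1 : R :=
  inf [set m | exists2 c, paths z0 z1 c &
                 is_maximum [set Phi (c t) | t in `[0, 1]] m].

Definition superlevel Phi (a : R) : set X := [set x | a <= Phi x].

Definition separates H z0 z1 :=
  [/\ closed H, ~ H z0, ~ H z1 &
      connected_component (~` H) z0 <> connected_component (~` H) z1].

End minimax.

(* Main.v *)
(** Write N x = 1 + |x|, and let H be F intersected with {g <= Phi}, where g is the
  minimax level. If no point x within distance 2 e N x of F, with Phi between g
  and g + e, had a gradient element of norm at most e / N x, then by Hahn-Banach
  each such point x would have a direction u with |u| <= 2 N along which Phi
  decreases at rate at least e, uniformly near x. Compositions of bump-shaped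
  pushes along such directions move every point below itself in the order
  [descent], in which the displacement relative to N is controlled by the
  decrease of Phi. Applying stages of such pushes, with radii within a factor 2
  of the largest possible ones, every trajectory starting on a nearly optimal
  path leaves the region: otherwise it would converge, by completeness, to a
  point of the region near which Phi decreases by a fixed amount at every stage.
  After leaving, it never meets H again. By compactness, finitely many stages
  carry the whole path off H, while its endpoints stay in their components of
  the complement of H, so that H does not separate them. Only the straight
  segment is needed to bound the distance delta from above. *)
Require Import Defs.
From HB Require Import structures.
From mathcomp Require Import all_boot all_order all_algebra.
From mathcomp Require Import all_classical all_reals all_analysis.
From mathcomp Require Import lra.
Set Implicit Arguments.
Unset Strict Implicit.
Unset Printing Implicit Defensive.

Import Order.TTheory GRing.Theory Num.Theory.
Import numFieldNormedType.Exports.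
Local Open Scope classical_set_scope.
Local Open Scope ring_scope.

(** * The Hahn-Banach theorem *)

Section hahn_banach.
Context {R : realType} {X : lmodType R}.
Implicit Types (p q : X -> R) (x v : X).

(** Homogeneity is asked only as an inequality, the form that infima inherit; applying it to the
    inverse scalar as well gives equality. *)
Definition sublinear p :=
  (forall v w, p (v + w) <= p v + p w) /\
  (forall s v, 0 < s -> p (s *: v) <= s * p v).

Lemma sublinearZ p s v : sublinear p -> 0 < s -> p (s *: v) = s * p v.
Proof.
move=> [_ pZ] s0; apply/eqP; rewrite eq_le pZ//=.
have := pZ s^-1 (s *: v); rewrite invr_gt0 scalerA mulVf ?gt_eqF// scale1r.
by move=> /(_ s0); rewrite -(ler_pM2l s0) mulrA mulfV ?gt_eqF// mul1r.
Qed.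

Lemma sublinear0 p : sublinear p -> p 0 = 0.
Proof.
move=> sp; have := sublinearZ 0 sp (ltr0Sn _ 1); rewrite scaler0; lra.
Qed.

Lemma sublinear_ge p v : sublinear p -> - p (- v) <= p v.
Proof.
move=> sp; have := sp.1 v (- v); rewrite subrr sublinear0//; lra.
Qed.

(** One criterion for all the functionals built below as pointwise infima: lower bounds of chains,
    infimal convolutions and Clarke derivatives. *)
Lemma sublinear_inf (P : X -> set R) :
    (forall v, has_inf (P v)) ->
    (forall v w a b, P v a -> P w b -> exists2 c, P (v + w) c & c <= a + b) ->
    (forall s v a, 0 < s -> P v a -> P (s *: v) (s * a)) ->
  sublinear (fun v => inf (P v)).
Proof.
move=> infP PD PZ; split => [v w|s v s0].
- apply/ler_addgt0Pl => e e0.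
  have e20 : 0 < e / 2 by rewrite divr_gt0.
  have [a Pa alt] := inf_adherent e20 (infP v).
  have [b Pb blt] := inf_adherent e20 (infP w).
  have [c Pc cab] := PD _ _ _ _ Pa Pb.
  have : inf (P (v + w)) <= c by apply: ge_inf => //; exact: (infP _).2.
  lra.
- rewrite -ler_pdivrMl//; apply: lb_le_inf; first exact: (infP v).1.
  move=> a Pa; rewrite ler_pdivrMl//; apply: ge_inf; first exact: (infP _).2.
  exact: PZ.
Qed.

(* Any minimal sublinear functional is additive: for fixed x, the functional
   v |-> inf_(t >= 0) (q (v + t x) - t q x) is sublinear and below q. *)
Lemma minimal_sublinear_additive q : sublinear q ->
    (forall q', sublinear q' -> (forall v, q' v <= q v) -> forall v, q v <= q' v) ->
  forall v x, q (v + x) = q v + q x.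
Proof.
move=> sq qmin v x; apply/eqP; rewrite eq_le sq.1/=.
pose P w := [set a | exists2 t, 0 <= t & a = q (w + t *: x) - t * q x].
have Plb w : lbound (P w) (- q (- w)).
  move=> _ [t t0 ->]; have := sq.1 (w + t *: x) (- w).
  rewrite [X in q X](_ : _ = t *: x); last by rewrite addrAC subrr add0r.
  have -> : q (t *: x) = t * q x.
    move: t0; rewrite le_eqVlt => /predU1P[<-|]; last exact: sublinearZ.
    by rewrite scale0r mul0r sublinear0.
  lra.
have P0 w : P w (q w) by exists 0 => //; rewrite scale0r addr0 mul0r subr0.
have infP w : has_inf (P w) by split; [exists (q w)|exists (- q (- w))].
have sP : sublinear (fun w => inf (P w)).
  apply: sublinear_inf => // [w1 w2 _ _ [t t0 ->] [s s0 ->]|s w _ s0 [t t0 ->]].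
  - exists (q (w1 + w2 + (t + s) *: x) - (t + s) * q x).
      by exists (t + s) => //; rewrite addr_ge0.
    have := sq.1 (w1 + t *: x) (w2 + s *: x).
    rewrite [X in q X](_ : _ = w1 + w2 + (t + s) *: x); first lra.
    by rewrite scalerDl addrACA.
  - exists (s * t); first by rewrite mulr_ge0 // ltW.
    by rewrite -scalerA -scalerDr sublinearZ// mulrBr mulrA.
have := qmin _ sP (fun w => ge_inf (infP w).2 (P0 w)) v.
(* Minimality gives [q v <= inf (P v)]; the member with t = 1 turns this into the missing
   inequality. *)
have Pv : P v (q (v + x) - q x) by exists 1; rewrite ?scale1r ?mul1r.
by move=> /le_trans/(_ (ge_inf (infP v).2 Pv)); rewrite lerBrDr.
Qed.

(** Zorn's lemma gives a minimal sublinear functional below p; being additive, it is odd, hence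
    linear. Chains are bounded by their pointwise infimum, which is finite because of the lower
    bound [- p (- v)]. *)
Lemma hahn_banach p : sublinear p ->
  exists y : {linear X -> R^o}, forall v, (y v : R) <= p v.
Proof.
move=> sp; pose T := {q | sublinear q /\ forall v, q v <= p v}.
pose below (q q' : T) := `[< forall v, sval q' v <= sval q v >].
have pT : sublinear p /\ forall v, p v <= p v by [].
have [||A Atot|[q [sq qp]] qmin] :=
    @ZL_preorder T (exist _ p pT) below.
- by move=> q; apply/asboolP.
- by move=> a b c /asboolP ab /asboolP bc; apply/asboolP => v; exact: le_trans.
- have [->|/set0P[q0 Aq0]] := eqVneq A set0; first by exists (exist _ p pT).
  pose P v := [set sval q v | q in A].
  have infP v : has_inf (P v).
    split; first by exists (sval q0 v); exists q0.
    exists (- p (- v)) => _ [q _ <-]; case: q => q [sq qp] /=.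
    by apply: le_trans (sublinear_ge v sq); rewrite lerN2.
  have sP : sublinear (fun v => inf (P v)).
    apply: sublinear_inf => // [v w _ _ [q Aq <-] [q' Aq' <-]|].
      have [/asboolP qq'|/asboolP qq'] := Atot _ _ Aq Aq'.
        exists (sval q' (v + w)); first by exists q'.
        by rewrite (le_trans ((svalP q').1.1 _ _))// lerD2r.
      exists (sval q (v + w)); first by exists q.
      by rewrite (le_trans ((svalP q).1.1 _ _))// lerD2l.
    move=> s v _ s0 [q Aq <-]; exists q => //.
    by rewrite (sublinearZ _ (svalP q).1).
  have infle (q1 : T) v : A q1 -> inf (P v) <= sval q1 v.
    by move=> Aq; apply: ge_inf; [exact: (infP v).2|exists q1].
  unshelve eexists (exist _ (fun v => inf (P v)) _).
    by split=> // v; exact: le_trans (infle _ _ Aq0) ((svalP q0).2 v).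
  by move=> q1 Aq1; apply/asboolP => v /=; exact: infle.
- have qD := minimal_sublinear_additive sq.
  have {}qD v x : q (v + x) = q v + q x.
    apply: qD => q' sq' q'q w.
    have q'T : sublinear q' /\ forall v, q' v <= p v.
      by split=> // u; exact: le_trans (qp u).
    have /qmin/asboolP/(_ w) // : below (exist _ q (conj sq qp)) (exist _ q' q'T).
    exact/asboolP.
  have qN v : q (- v) = - q v.
    by apply/eqP; rewrite -addr_eq0 -qD addNr sublinear0.
  have qZ (a : R) v : q (a *: v) = a * q v.
    have [a0|a0|->] := ltgtP a 0.
    - by rewrite -[a]opprK scaleNr qN mulNr (sublinearZ _ sq) ?oppr_gt0.
    - exact: sublinearZ.
    - by rewrite scale0r mul0r sublinear0.
  have lq : linear (q : X -> R^o) by move=> a u v; rewrite qD qZ.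
  pose y : {linear X -> R^o} := HB.pack_for {linear X -> R^o} (q : X -> R^o)
    (GRing.isLinear.Build R X R^o *:%R (q : X -> R^o) lq).
  by exists y.
Qed.

End hahn_banach.

(** * Clarke's generalized gradient *)

Section clarke_calculus.
Context {R : realType} {X : normedModType R}.
Variable Phi : X -> R.
Hypothesis hPhi : locally_lipschitz Phi.
Implicit Types x v w : X.

Lemma locally_lipschitz_ball x : exists L r : R, [/\ 0 <= L, 0 < r &
  forall y z, `|y - x| < r -> `|z - x| < r -> `|Phi y - Phi z| <= L * `|y - z|].
Proof.
have [U /nbhs_ballP[r /= r0 rU] [k [_ /(_ (`|k| + 1))]]] := hPhi x.
rewrite (le_lt_trans (ler_norm _)) ?ltrDl// => /(_ isT) lip.
exists (`|k| + 1), r; split => // y z yx zx.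
by apply: (lip (y, z)); split => /=; apply: rU; rewrite -ball_normE/= distrC.
Qed.

Lemma locally_lipschitz_continuous : continuous Phi.
Proof.
move=> x; have [L [r [L0 r0 lip]]] := locally_lipschitz_ball x.
apply/cvgrPdist_le => /= e e0; near=> y.
have yx : `|y - x| < r.
  by near: y; exact: (@cvgr_distC_lt _ _ _ _ _ id x).
rewrite (le_trans (lip _ _ _ yx))// ?subrr ?normr0//.
have : `|x - y| <= e / (L + 1).
  near: y; apply: (@cvgr_dist_le _ _ _ _ _ id x) => //.
  by rewrite divr_gt0// ltr_wpDl.
rewrite ler_pdivlMr ?ltr_wpDl// => /(le_trans _); apply.
by rewrite mulrC ler_wpM2l// lerDl.
Unshelve. all: by end_near. Qed.

(** Multiplied out by t, these are the upper bounds of the difference quotients near x and 0+; their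
    infimum is the real form of [clarke_derivative]. *)
Definition upper_slopes x v : set R :=
  [set a | exists2 r, 0 < r & forall w t, `|w - x| < r -> 0 < t < r ->
    Phi (w + t *: v) - Phi w <= a * t].

Lemma upper_slopes_lipschitz x : exists2 L, 0 <= L & forall v,
  upper_slopes x v (L * `|v|) /\ lbound (upper_slopes x v) (- (L * `|v|)).
Proof.
have [L [r [L0 r0 lip]]] := locally_lipschitz_ball x; exists L => // v.
have v1 : 0 < 1 + `|v| by rewrite ltr_pwDl.
split.
- exists (r / 2 / (1 + `|v|)); first by rewrite !divr_gt0.
  move=> w t wx /andP[t0 tr].
  have wr : `|w - x| < r / 2.
    apply: lt_le_trans wx _; rewrite ler_pdivrMr//.
    by rewrite ler_peMr// ?lerDl// ltW// divr_gt0.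
  have tv : t * `|v| < r / 2.
    move: tr; rewrite ltr_pdivlMr// mulrDr mulr1; lra.
  rewrite (le_trans (ler_norm _))// (le_trans (lip _ _ _ _))//.
  + rewrite addrAC (le_lt_trans (ler_normD _ _))// normrZ gtr0_norm//; lra.
  + lra.
  + by rewrite addrAC subrr add0r normrZ gtr0_norm// mulrA mulrAC.
- move=> a [r1 r10 ha].
  (* For the lower bound a single test suffices, at w = x and a t with both t < r1 and t |v| < r. *)
  pose t := Num.min r r1 / 2 / (1 + `|v|).
  have m0 : 0 < Num.min r r1 by rewrite lt_min r0 r10.
  have t0 : 0 < t by rewrite !divr_gt0.
  have tm : t + t * `|v| = Num.min r r1 / 2.
    by rewrite -{1}[t]mulr1 -mulrDr /t divfK// gt_eqF.
  have tv0 : 0 <= t * `|v| by rewrite mulr_ge0// ltW.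
  have mr : Num.min r r1 <= r by rewrite ge_min lexx.
  have mr1 : Num.min r r1 <= r1 by rewrite ge_min lexx orbT.
  have := ha x t; rewrite subrr normr0 r10 t0 => /(_ isT).
  have -> : t < r1 by lra.
  move=> /(_ isT) hat.
  have := lip (x + t *: v) x.
  rewrite subrr normr0 addrAC subrr add0r normrZ gtr0_norm//.
  have -> : t * `|v| < r by lra.
  rewrite r0 => /(_ isT isT); rewrite ler_norml => /andP[lo _].
  rewrite -(ler_pM2r t0); lra.
Qed.

Lemma has_inf_upper_slopes x v : has_inf (upper_slopes x v).
Proof.
have [L _ /(_ v)[Lv lbL]] := upper_slopes_lipschitz x.
by split; [exists (L * `|v|)|exists (- (L * `|v|))].
Qed.

Lemma clarke_derivativeE x v :
  clarke_derivative Phi x v = (inf (upper_slopes x v))%:E.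
Proof.
apply/eqP; rewrite eq_le; apply/andP; split.
- apply/lee_addgt0Pr => e e0; rewrite -EFinD.
  have [a [r r0 ha] ae] := inf_adherent e0 (has_inf_upper_slopes x v).
  apply: le_trans (_ : a%:E <= _)%E; last by rewrite lee_fin ltW.
  apply: ge_ereal_inf.
  set f := fun wt : X * R => _.
  exists (ereal_sup (f @` [set wt | `|wt.1 - x| < r /\ 0 < wt.2 < r])).
    exists [set wt | `|wt.1 - x| < r /\ 0 < wt.2 < r] => //.
    exists ([set w | `|w - x| < r], [set t | 0 < t < r]) => /=; last by move=> [].
    split.
      by apply/nbhs_ballP; exists r => //= w; rewrite -ball_normE /= distrC.
    near=> t; apply/andP; split; first by near: t; exact: nbhs_right_gt.
    by near: t; exact: nbhs_right_lt.
  apply: ge_ereal_sup => _ [[w t] /= [wx /andP[t0 tr]] <-].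
  by rewrite lee_fin ler_pdivrMr// ha// t0.
- apply: le_ereal_inf_tmp => _ [V [[A B]/= [Ax B0] ABV] <-].
  rewrite leNgt; apply/negP => supV.
  (* Such an a would itself be an upper slope below the infimum. A finite supremum serves as a; if
     it is minus infinity, any real below the infimum does. *)
  have [a supa ai] : exists2 a : R,
      (ereal_sup [set ((Phi (wt.1 + wt.2 *: v) - Phi wt.1) / wt.2)%:E
                 | wt in V] <= a%:E)%E & a < inf (upper_slopes x v).
    move: supV; case: ereal_sup => [s||] //.
      by rewrite lte_fin => ?; exists s.
    by exists (inf (upper_slopes x v) - 1); rewrite ?leNye// ltrBlDr ltrDl.
  suff : upper_slopes x v a.
    by move=> /(ge_inf (has_inf_upper_slopes x v).2); rewrite leNgt ai.
  move/nbhs_ballP: Ax => [r1 /= r10 r1A].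
  have [r2 /= r20 r2B] := B0.
  exists (Num.min r1 r2); first by rewrite lt_min r10 r20.
  move=> w t; rewrite !lt_min => /andP[wx _] /and3P[t0 _ tr].
  rewrite -ler_pdivrMr// -lee_fin; apply: le_trans supa.
  apply: ereal_sup_ubound; exists (w, t) => //; apply: ABV; split => /=.
    by apply: r1A; rewrite -ball_normE/= distrC.
  by apply: r2B => //=; rewrite sub0r normrN gtr0_norm.
Unshelve. all: by end_near. Qed.

(** A step along v + w is split at the point reached along v; that point is again near x, and
    [upper_slopes] lets the base point vary near x. *)
Lemma upper_slopes_sublinear x : sublinear (fun v => inf (upper_slopes x v)).
Proof.
apply: sublinear_inf; first exact: has_inf_upper_slopes.
- move=> v w a b [r r0 ha] [s s0 hb]; exists (a + b) => //.
  have v1 : 0 < 1 + `|v| by rewrite ltr_pwDl.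
  have m0 : 0 < Num.min r s by rewrite lt_min r0 s0.
  exists (Num.min r s / 2 / (1 + `|v|)); first by rewrite !divr_gt0.
  move=> z t zx /andP[t0 tr].
  have mr : Num.min r s <= r by rewrite ge_min lexx.
  have ms : Num.min r s <= s by rewrite ge_min lexx orbT.
  have hm : Num.min r s / 2 / (1 + `|v|) <= Num.min r s / 2.
    by rewrite ler_pdivrMr// ler_peMr// ?lerDl// ltW// divr_gt0//.
  have tv : t * `|v| < Num.min r s / 2.
    move: tr; rewrite ltr_pdivlMr// mulrDr mulr1; lra.
  have zr : `|z - x| < r by lra.
  have zs : `|z + t *: v - x| < s.
    rewrite addrAC (le_lt_trans (ler_normD _ _))// normrZ gtr0_norm//; lra.
  have tr' : 0 < t < r by rewrite t0/=; lra.
  have ts' : 0 < t < s by rewrite t0/=; lra.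
  have := ha _ _ zr tr'; have := hb _ _ zs ts'.
  rewrite -addrA -scalerDr; lra.
- move=> s v a s0 [r r0 ha].
  have m0 : 0 < Num.min r (r / s) by rewrite lt_min r0 divr_gt0.
  exists (Num.min r (r / s)) => // w t; rewrite !lt_min.
  move=> /andP[wr _] /and3P[t0 tr]; rewrite ltr_pdivlMr// => tsr.
  have := ha w (t * s) wr; rewrite mulr_gt0//= tsr => /(_ isT).
  by rewrite scalerA; lra.
Qed.

(** Continuity of y follows from the domination, since the local Lipschitz bound makes the infimum
    of the slopes at most a multiple of |v|. *)
Lemma clarke_gradientP x (y : {linear X -> R^o}) :
  clarke_gradient Phi x y <-> forall v, (y v : R) <= inf (upper_slopes x v).
Proof.
split=> [[_ yle] v|yle].
  by rewrite -lee_fin -clarke_derivativeE; exact: yle.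
split=> [|v]; last by rewrite clarke_derivativeE lee_fin.
have [L L0 hL] := upper_slopes_lipschitz x.
have yL v : (y v : R) <= L * `|v|.
  by apply: le_trans (yle v) _; apply: ge_inf; [exists (- (L * `|v|))|]; case: (hL v).
apply: bounded_linear_continuous; apply/bounded_funP => r.
exists (L * r) => v vr; apply: le_trans (_ : L * `|v| <= _); last exact: ler_wpM2l.
rewrite ler_norml yL andbT lerNl; have := yL (- v).
by rewrite linearN normrN.
Qed.

End clarke_calculus.

(** * Attainment of the least dual norm in the gradient *)

Section least_dual_norm.
Context {R : realType} {X : normedModType R}.
Implicit Types (p : X -> R) (y : {linear X -> R^o}) (v w : X).

Lemma linear_normr_le y (m : R) :
  (forall v, (y v : R) <= m * `|v|) -> forall v, `|y v| <= m * `|v|.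
Proof.
move=> ym v; rewrite ler_norml ym andbT lerNl.
by have := ym (- v); rewrite linearN normrN.
Qed.

Lemma dual_norm_le y (m : R) : 0 <= m ->
  (forall v, (y v : R) <= m * `|v|) -> dual_norm y <= m.
Proof.
move=> m0 ym; apply: ge_sup; first by exists `|y 0|, 0 => //=; rewrite normr0.
move=> _ [v /= v1 <-]; apply: (le_trans (linear_normr_le ym v)).
by rewrite ler_piMr.
Qed.

Lemma dual_norm_ge y (m : R) v : (forall v, (y v : R) <= m * `|v|) ->
  `|v| <= 1 -> `|y v| <= dual_norm y.
Proof.
move=> ym v1; apply: ub_le_sup; last by exists v.
exists `|m| => _ [w /= w1 <-]; apply: (le_trans (linear_normr_le ym w)).
by rewrite (le_trans (ler_wpM2r _ (ler_norm m)))// ler_piMr.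
Qed.

(* Hahn-Banach for the infimal convolution of p with m |.|: a linear functional
   below it is below both p and m |.|. *)
Lemma sublinear_linear_minorant p (m : R) : sublinear p -> 0 <= m ->
    (forall v, - p v <= m * `|v|) ->
  exists y, forall v, (y v : R) <= p v /\ (y v : R) <= m * `|v|.
Proof.
move=> sp m0 pm; pose P v := [set p w + m * `|v - w| | w in setT].
have infP v : has_inf (P v).
  split; first by exists (p v + m * `|v - v|); exists v.
  exists (- p (- v)) => _ [w _ <-].
  have := sp.1 w (- v); have := pm (w - v); rewrite distrC; lra.
have sP : sublinear (fun v => inf (P v)).
  apply: sublinear_inf => // [v w _ _ [v' _ <-] [w' _ <-]|s v _ s0 [v' _ <-]].
  - exists (p (v' + w') + m * `|v + w - (v' + w')|); first by exists (v' + w').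
    have := ler_wpM2l m0 (ler_normD (v - v') (w - w')).
    rewrite mulrDr addrACA -opprD; have := sp.1 v' w'; lra.
  - exists (s *: v') => //.
    by rewrite -scalerBr normrZ gtr0_norm// (sublinearZ _ sp)//; lra.
have [y yP] := hahn_banach sP; exists y => v.
split; apply: (le_trans (yP v)); apply: ge_inf; try exact: (infP v).2.
- by exists v => //; rewrite subrr normr0 mulr0 addr0.
- by exists 0 => //; rewrite subr0 sublinear0// add0r.
Qed.

(** The least norm is the supremum of [- p] over the unit ball: every gradient element is below p,
    so has at least that norm, and a linear functional below both p and that multiple of the norm
    attains it. *)
Lemma clarke_gradient_least_norm (Phi : X -> R) x (a : R) :
    locally_lipschitz Phi ->
    (forall v, `|v| <= 1 -> ((- a)%:E <= clarke_derivative Phi x v)%E) ->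
  exists2 m, 0 <= m <= a &
    is_minimum [set dual_norm y | y in clarke_gradient Phi x] m.
Proof.
move=> hPhi ha.
have sp := upper_slopes_sublinear hPhi x.
have pa v : `|v| <= 1 -> - inf (upper_slopes Phi x v) <= a.
  by move=> /ha; rewrite clarke_derivativeE// lee_fin lerNl.
set p := fun v => inf (upper_slopes Phi x v) in sp pa.
pose A := [set - p v | v in [set v | `|v| <= 1]].
have A0 : A 0 by exists 0; rewrite /= ?normr0// sublinear0// oppr0.
have supA : has_sup A.
  by split; [exists 0|exists a => _ [v /= v1 <-]; exact: pa].
have m0 : 0 <= sup A by apply: sup_upper_bound.
have pm v : - p v <= sup A * `|v|.
  have [->|v0] := eqVneq v 0; first by rewrite normr0 mulr0 sublinear0// oppr0.
  have nv0 : 0 < `|v| by rewrite normr_gt0.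
  have : - p (`|v|^-1 *: v) <= sup A.
    apply: sup_upper_bound => //; exists (`|v|^-1 *: v) => //=.
    by rewrite normrZ normfV normr_id mulVf// gt_eqF.
  by rewrite sublinearZ ?invr_gt0// -mulrN ler_pdivrMl// mulrC.
have [y yle] := sublinear_linear_minorant sp m0 pm.
have ybound y' : clarke_gradient Phi x y' -> exists L, forall v, (y' v : R) <= L * `|v|.
  move=> /(clarke_gradientP hPhi) y'p.
  have [L _ hL] := upper_slopes_lipschitz hPhi x; exists L => v.
  apply: le_trans (y'p v) _; apply: ge_inf; last exact: (hL v).1.
  by exists (- (L * `|v|)); exact: (hL v).2.
have lb : lbound [set dual_norm y | y in clarke_gradient Phi x] (sup A).
  move=> _ [y' hy' <-]; have [L yL] := ybound _ hy'.
  apply: ge_sup; first by exists 0.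
  move=> _ [v /= v1 <-]; apply: le_trans (dual_norm_ge yL v1).
  rewrite -normrN; apply: le_trans (ler_norm _); rewrite lerN2.
  exact: (clarke_gradientP hPhi _ _).1 hy' v.
have gy : clarke_gradient Phi x y.
  by apply/clarke_gradientP => // v; case: (yle v).
exists (sup A).
  by rewrite m0/=; apply: ge_sup; [exists 0|move=> _ [v /= v1 <-]; exact: pa].
split=> //; exists y => //; apply/eqP; rewrite eq_le lb ?andbT; last by exists y.
by apply: dual_norm_le => // v; case: (yle v).
Qed.

End least_dual_norm.

(** * The distance delta *)

Section delta_upper_bound.
Context {R : realType} {X : normedModType R}.
Implicit Types (c : R -> X) (x y : X) (F : set X).

(** Properness makes the limit defining [derive01] unique, also at the endpoints: from the left half
    one can move right, from the right half left. *)
Lemma dnbhs_within01_proper (t : R) : t \in `[0, 1] ->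
  ProperFilter (within `[0, 1] t^').
Proof.
rewrite in_itv/= => /andP[t0 t1].
apply: Build_ProperFilter_ex => P /nbhs_ballP[e /= e0 eP].
pose d := Num.min e 1 / 2.
have d0 : 0 < d by rewrite divr_gt0// lt_min e0 ltr01.
have de : d < e.
  by rewrite ltr_pdivrMr// (le_lt_trans (_ : _ <= e))// ?ge_min ?lexx// ltr_pMr// ltrDl.
have d12 : d <= 1 / 2 by rewrite ler_pM2r// ge_min lexx orbT.
have [th|th] := leP t (1 / 2).
- exists (t + d); apply: eP => /=.
  + by rewrite -ball_normE/= opprD addrA subrr sub0r normrN gtr0_norm.
  + by rewrite -subr_eq0 addrAC subrr add0r gt_eqF.
  + by rewrite in_itv/=; apply/andP; split; lra.
- exists (t - d); apply: eP => /=.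
  + by rewrite -ball_normE/= opprD addrA subrr sub0r opprK gtr0_norm.
  + by rewrite -subr_eq0 addrAC subrr add0r oppr_eq0 gt_eqF.
  + by rewrite in_itv/=; apply/andP; split; lra.
Qed.

Definition segment x y (t : R) : X := x + t *: (y - x).

Let segment_near_cst x y (t : R) :
  \forall s \near within `[0, 1] t^', difference_quotient (segment x y) t s = y - x.
Proof.
near=> s.
rewrite /difference_quotient /segment opprD addrACA subrr add0r -scalerBl.
rewrite scalerA mulVf ?scale1r// subr_eq0.
near: s; exact: (filterS _ (nbhs_dnbhs_neq _)).
Unshelve. all: by end_near. Qed.

Lemma derivable01_segment x y (t : R) : t \in `[0, 1] ->
  derivable01 (segment x y) t.
Proof.
move=> /dnbhs_within01_proper ?; apply: (is_cvg_near_cst (y - x)).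
exact: segment_near_cst.
Qed.

Lemma derive01_segment x y (t : R) : t \in `[0, 1] ->
  derive01 (segment x y) t = y - x.
Proof.
move=> /dnbhs_within01_proper ?; apply: lim_near_cst => //.
Qed.

Lemma C1_curve_segment x y : C1_curve (segment x y).
Proof.
split; first by move=> t; exact: derivable01_segment.
apply: (@subspace_eq_continuous _ _ _ (fun=> y - x)).
  by move=> t; rewrite inE/= => t01; apply/esym/derive01_segment.
by apply: continuous_subspaceT => t; exact: cst_continuous.
Qed.

Lemma continuous_segment x y : continuous (segment x y).
Proof.
move=> t; apply: cvgD; first exact: cvg_cst.
by apply: cvgZr_tmp; exact: cvg_id.
Qed.

Lemma delta_length_ge0 c : 0 <= delta_length c.
Proof. by apply: Rintegral_ge0 => t _; rewrite divr_ge0// addr_ge0. Qed.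

Lemma delta_ge0 x y : 0 <= delta x y.
Proof.
apply: lb_le_inf; last by move=> _ [c _ <-]; exact: delta_length_ge0.
exists (delta_length (segment x y)), (segment x y) => //; split.
- exact: C1_curve_segment.
- by rewrite /segment scale0r addr0.
- by rewrite /segment scale1r addrC subrK.
Qed.

Lemma delta_le_segment x y : delta x y <= delta_length (segment x y).
Proof.
apply: ge_inf; first by exists 0 => _ [c _ <-]; exact: delta_length_ge0.
exists (segment x y) => //; split.
- exact: C1_curve_segment.
- by rewrite /segment scale0r addr0.
- by rewrite /segment scale1r addrC subrK.
Qed.

(** Along the segment 1 + |c(t)| is at least (1 - e) (1 + |x|), hence at least half of 1 + |x|, so
    that the integrand is at most 2 e. *)
Lemma delta_le x y (e : R) : e <= 1 / 2 -> `|x - y| <= e * (1 + `|x|) ->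
  delta x y <= 2 * e.
Proof.
move=> e12 xy; apply: le_trans (delta_le_segment x y) _.
have e0 : 0 <= e.
  by rewrite -(@pmulr_lge0 _ (1 + `|x|)) ?ltr_pwDl// (le_trans _ xy).
have -> : 2 * e = \int[@lebesgue_measure R]_(t in `[0, 1]) (2 * e).
  rewrite Rintegral_cst//= lebesgue_measure_itv/= lte01 /=.
  by rewrite oppr0 addr0 mulr1.
have -> : delta_length (segment x y) = \int[@lebesgue_measure R]_(t in `[0, 1])
    (`|y - x| / (1 + `|segment x y t|)).
  by apply: eq_Rintegral => t; rewrite inE/= => t01; rewrite derive01_segment.
apply: le_Rintegral => //.
- apply: continuous_compact_integrable; first exact: segment_compact.
  apply: continuous_subspaceT => t; apply: cvgM; first exact: cvg_cst.
  apply: cvgV; first by rewrite gt_eqF// ltr_pwDl.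
  apply: cvgD; first exact: cvg_cst.
  by apply: cvg_norm; exact: continuous_segment.
- apply: continuous_compact_integrable; first exact: segment_compact.
  by apply: continuous_subspaceT => t; exact: cvg_cst.
- move=> t /=; rewrite in_itv/= => /andP[t0 t1].
  rewrite ler_pdivrMr ?ltr_pwDl// distrC (le_trans xy)//.
  have xE : x = segment x y t + t *: (x - y).
    by rewrite /segment -addrA -scalerDr addrA subrK subrr scaler0 addr0.
  have := ler_normD (segment x y t) (t *: (x - y)).
  rewrite -xE normrZ ger0_norm//.
  have : t * `|x - y| <= `|x - y| by rewrite ler_piMl.
  have := mulr_ge0 e0 (normr_ge0 x); have := normr_ge0 x.
  nra.
Qed.

Lemma dist_delta_ge0 x F : F !=set0 -> 0 <= dist_delta x F.
Proof.
move=> [y Fy]; apply: lb_le_inf; first by exists (delta x y), y.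
by move=> _ [z _ <-]; exact: delta_ge0.
Qed.

Lemma dist_delta_le x y F (e : R) : F y -> e <= 1 / 2 ->
  `|x - y| <= e * (1 + `|x|) -> dist_delta x F <= 2 * e.
Proof.
move=> Fy e12 xy; apply: le_trans (delta_le e12 xy).
apply: ge_inf; last by exists y.
by exists 0 => _ [z _ <-]; exact: delta_ge0.
Qed.

End delta_upper_bound.

(** * Deformation *)

Section deformation.
Context {R : realType} {X : completeNormedModType R}.
Variables (Phi : X -> R) (e : R).
Hypothesis e0 : 0 < e.
Implicit Types (x y z w u : X) (r : R).

(** A push of duration t moves w by at most 2 t N w and lowers Phi by at least t e; k bounds the
    ratio of relative displacement to decrease. *)
Let k : R := 2 / e.
Let k_gt0 : 0 < k. Proof. by rewrite divr_gt0. Qed.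
Let N x : R := 1 + `|x|.
Let N_gt0 x : 0 < N x. Proof. by rewrite ltr_pwDl. Qed.

(* A Caristi-type order: the displacement, relative to 1 + |x|, is paid for by
   the decrease of Phi. The exponential makes it transitive, because
   1 + |y| <= (1 + |x|) expR (k * (Phi x - Phi y)) whenever y is below x. *)
Definition descent x y :=
  Phi y <= Phi x /\ `|y - x| <= N x * (expR (k * (Phi x - Phi y)) - 1).

Lemma descent_refl x : descent x x.
Proof. by split; rewrite // !subrr mulr0 expR0 subrr mulr0 normr0. Qed.

Lemma descent_weight x y : descent x y ->
  N y <= N x * expR (k * (Phi x - Phi y)).
Proof.
move=> [_]; have := ler_normD (y - x) x; rewrite subrK mulrBr mulr1 /N; lra.
Qed.

Lemma descent_trans x y z : descent x y -> descent y z -> descent x z.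
Proof.
move=> xy [zy dzy]; have Ny := descent_weight xy; case: xy => [yx dyx].
split; first exact: le_trans yx.
have -> : Phi x - Phi z = (Phi x - Phi y) + (Phi y - Phi z).
  by rewrite addrA subrK.
rewrite [k * _]mulrDr expRD; move: dyx dzy Ny.
set a := expR _; set b := expR _ => dyx dzy Ny.
have b1 : 0 <= b - 1.
  by rewrite subr_ge0 -expR0 ler_expR mulr_ge0 ?subr_ge0// ltW.
have := ler_wpM2r b1 Ny; have := ler_normD (z - y) (y - x).
rewrite addrA subrK; move: dyx dzy.
lra.
Qed.

Definition push x r u := forall w, `|w - x| < r ->
  `|u| <= 2 * N w /\ forall t, 0 <= t < r -> Phi (w + t *: u) <= Phi w - t * e.

(** The amplitude vanishes continuously at the boundary of the ball, and the factor 1/2 keeps it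
    below r, within the times that [push] covers. *)
Definition bump x r u w := w + (Num.max 0 (r - `|w - x|) / 2) *: u.

Let amplitude_ge0 x r w : 0 <= Num.max 0 (r - `|w - x|) / 2.
Proof. by rewrite divr_ge0// le_max lexx. Qed.

Lemma bump_continuous x r u : continuous (bump x r u).
Proof.
move=> w; apply: cvgD; first exact: cvg_id.
apply: cvgZr_tmp; apply: cvgMr_tmp.
apply: (@continuous_max R X (cst 0) (fun y => r - `|y - x|) w).
  exact: cst_continuous.
apply: cvgB; first exact: cvg_cst.
by apply: cvg_norm; apply: cvgB; [exact: cvg_id|exact: cvg_cst].
Qed.

Lemma bump_outside x r u w : r <= `|w - x| -> bump x r u w = w.
Proof.
by rewrite -subr_le0 /bump => /max_idPl ->; rewrite mul0r scale0r addr0.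
Qed.

Lemma bump_segment x r u w t : push x r u -> 0 <= t <= 1 -> `|w - x| < r ->
  Phi (w + (t * (Num.max 0 (r - `|w - x|) / 2)) *: u) <=
  Phi w - t * (Num.max 0 (r - `|w - x|) / 2) * e.
Proof.
move=> pu /andP[t0 t1] wx; have [_] := pu _ wx; apply.
have a0 := amplitude_ge0 x r w; rewrite mulr_ge0//=.
have ar : Num.max 0 (r - `|w - x|) / 2 < r.
  have := normr_ge0 (w - x); have [_|_] := leP 0 (r - `|w - x|); lra.
by apply: le_lt_trans ar; rewrite ler_piMl.
Qed.

(** The relative displacement is at most k times the decrease of Phi, and s <= expR s - 1. *)
Lemma bump_descent x r u w : push x r u -> descent w (bump x r u w).
Proof.
move=> pu; have [wx|wx] := leP r `|w - x|.
  by rewrite bump_outside//; exact: descent_refl.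
have := @bump_segment x r u w 1 pu _ wx; rewrite ler01 lexx => /(_ isT).
have [uN _] := pu _ wx.
rewrite mul1r -/(bump x r u w) => PhiB; have a0 := amplitude_ge0 x r w.
have B : `|bump x r u w - w| = Num.max 0 (r - `|w - x|) / 2 * `|u|.
  by rewrite /bump addrAC subrr add0r normrZ ger0_norm.
set a := Num.max 0 _ / 2 in PhiB a0 B.
have ae : 0 <= a * e by rewrite mulr_ge0// ltW.
split; first lra.
rewrite B; apply: le_trans (_ : N w * (k * (Phi w - Phi (bump x r u w))) <= _).
  rewrite mulrC; apply: le_trans (ler_wpM2r a0 uN) _.
  rewrite -mulrA mulrCA ler_wpM2l ?(ltW (N_gt0 _))// /k.
  by rewrite mulrAC ler_pdivlMr// -mulrA ler_wpM2l//; lra.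
rewrite ler_wpM2l ?(ltW (N_gt0 _))//.
by have := expR_ge1Dx (k * (Phi w - Phi (bump x r u w))); lra.
Qed.

Lemma bump_decrease x r u w : push x r u -> `|w - x| < r / 2 ->
  Phi (bump x r u w) <= Phi w - e * (r / 4).
Proof.
move=> pu wr; have := normr_ge0 (w - x) => n0.
have wx : `|w - x| < r by lra.
have := @bump_segment x r u w 1 pu _ wx; rewrite ler01 lexx => /(_ isT).
rewrite mul1r -/(bump x r u w).
have -> : Num.max 0 (r - `|w - x|) = r - `|w - x|.
  by apply/max_idPr; rewrite subr_ge0 ltW.
by have := mulr_gt0 e0 (_ : 0 < r / 2 - `|w - x|); rewrite subr_gt0 wr => /(_ isT); nra.
Qed.

(* Along the segment from w to its image Phi is below its value at w, strictly
   except at w itself. *)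
Lemma bump_component (H : set X) (g : R) x r u w : push x r u ->
    (forall y, H y -> g <= Phi y) -> Phi w <= g -> ~ H w ->
  connected_component (~` H) w (bump x r u w).
Proof.
move=> pu Hg wg Hw; have [wx|wx] := leP r `|w - x|.
  by rewrite bump_outside//; exact: connected_component_refl.
pose a := Num.max 0 (r - `|w - x|) / 2.
have a0 : 0 < a by rewrite divr_gt0// lt_max subr_gt0 wx orbT.
pose c (t : R) := w + (t * a) *: u.
have cc : continuous c.
  move=> t; apply: cvgD; first exact: cvg_cst.
  by apply: cvgZr_tmp; apply: cvgMr_tmp; exact: cvg_id.
apply: (@connected_component_max _ _ (c @` `[0, 1])).
- by exists 0; rewrite /= ?in_itv/= ?lexx ?ler01// /c mul0r scale0r addr0.
- move=> _ [t /= + <-]; rewrite in_itv/= => /andP[t0 t1].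
  move: t0; rewrite le_eqVlt => /predU1P[<-|t0].
    by rewrite /c mul0r scale0r addr0.
  move=> /Hg; apply/negP; rewrite -ltNge.
  have := @bump_segment x r u w t pu _ wx; rewrite (ltW t0) t1 => /(_ isT).
  have := mulr_gt0 (mulr_gt0 t0 a0) e0; rewrite -/a -/(c t); lra.
- apply: connected_continuous_connected; first exact: segment_connected.
  exact: continuous_subspaceT.
- by exists 1; rewrite /= ?in_itv/= ?lexx ?ler01// /c mul1r.
Qed.

Lemma descent_sequence (x : nat -> X) : (forall n, descent (x n) (x n.+1)) ->
  forall n m, (n <= m)%N -> descent (x n) (x m).
Proof.
move=> dx n m /subnK <-; elim: (m - n)%N => [|d]; first exact: descent_refl.
by move=> /descent_trans; apply.
Qed.

(** The weights [N (x n)] stay bounded because the total decrease of Phi is, and the decrease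
    remaining after n tends to 0. Uniformity in m yields the Cauchy property; m = n + 1 controls the
    points passed within one stage. *)
Lemma descent_sequence_bound (x : nat -> X) (g : R) :
    (forall n, descent (x n) (x n.+1)) -> (forall n, g <= Phi (x n)) ->
  exists2 b : nat -> R, b n @[n --> \oo] --> 0 &
    forall n m, (n <= m)%N ->
      N (x n) * (expR (k * (Phi (x n) - Phi (x m))) - 1) <= b n.
Proof.
move=> dx gx.
have dnm := descent_sequence dx.
have Phidec : nonincreasing_seq (fun n => Phi (x n)).
  by move=> n m /dnm[].
have Phicvg : cvgn (fun n => Phi (x n)).
  apply: nonincreasing_is_cvgn => //.
  by exists g => _ [n _ <-].
pose L := limn (fun n => Phi (x n)).
have LPhi n : L <= Phi (x n) by exact: nonincreasing_cvgn_ge.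
exists (fun n => N (x 0%N) * expR (k * (Phi (x 0%N) - g)) *
                 (expR (k * (Phi (x n) - L)) - 1)).
  rewrite -[0](mulr0 (N (x 0%N) * expR (k * (Phi (x 0%N) - g)))).
  apply: cvgMl_tmp.
  have -> : 0 = expR (k * (L - L)) - 1 by rewrite subrr mulr0 expR0 subrr.
  apply: cvgB; last exact: cvg_cst.
  apply: continuous_cvg; first exact: continuous_expR.
  apply: cvgMl_tmp; apply: cvgB; [exact: Phicvg|exact: cvg_cst].
move=> n m nm; apply: ler_pM.
- exact/ltW.
- rewrite subr_ge0 -expR0 ler_expR mulr_ge0 ?(ltW k_gt0)// subr_ge0.
  by case: (dnm _ _ nm).
- apply: le_trans (descent_weight (dnm 0%N n _)) _ => //.
  by rewrite ler_pM2l// ler_expR ler_pM2l// lerD2l lerN2.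
- by rewrite lerD2r ler_expR ler_pM2l// lerD2l lerN2.
Qed.

Lemma descent_sequence_cvg (x : nat -> X) (g : R) :
  (forall n, descent (x n) (x n.+1)) -> (forall n, g <= Phi (x n)) -> cvgn x.
Proof.
move=> dx gx; have [b b0 xb] := descent_sequence_bound dx gx.
have dnm := descent_sequence dx.
apply/cauchy_cvgP/cauchy_exP => d d0.
have [n _ bn] : \forall n \near \oo, b n < d.
  move/cvgrPdist_lt: b0 => /(_ _ d0); apply: filterS => n.
  by rewrite sub0r normrN => /(le_lt_trans (ler_norm _)).
exists (x n), n => // m /= nm; rewrite -ball_normE/= distrC.
apply: le_lt_trans (bn n (leqnn n)); apply: le_trans (xb _ _ nm).
by case: (dnm _ _ nm).
Qed.

End deformation.

(** * Stages as compositions of bumps, and their trajectories *)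

Section stages.
Context {R : realType} {X : completeNormedModType R}.
Variables (Phi : X -> R) (e g : R) (H S : set X).
Hypotheses (cPhi : continuous Phi) (e0 : 0 < e).
Hypothesis Hg : forall x, H x -> g <= Phi x.
Variables (rho : X -> R) (ups : X -> X).
Hypothesis push_rho : forall x, S x -> 0 < rho x /\ push Phi e x (rho x) (ups x).
Implicit Types (x y z w p : X) (s : seq X).

Let step x := bump x (rho x) (ups x).

(** Three properties stable under composition. The last is meant for the endpoints of a path, which
    start at or below level g and by descent stay there. *)
Record stage_map (f : X -> X) : Prop := StageMap {
  stage_continuous : continuous f ;
  stage_descent : forall w, descent Phi e w (f w) ;
  stage_component : forall w, Phi w <= g -> ~ H w ->
    connected_component (~` H) w (f w) }.

Lemma stage_map_id : stage_map id.
Proof.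
split=> [w|w|w _ Hw]; [exact: cvg_id|exact: descent_refl|].
exact: connected_component_refl.
Qed.

Lemma stage_map_comp f1 f2 : stage_map f1 -> stage_map f2 ->
  stage_map (f2 \o f1).
Proof.
move=> [c1 d1 m1] [c2 d2 m2]; split.
- by move=> w; apply: continuous_comp; [exact: c1|exact: c2].
- by move=> w; apply: (descent_trans e0) (d1 w) (d2 _).
- move=> w wg Hw; have w1 := m1 w wg Hw.
  apply: (connected_component_trans w1); apply: m2.
    by apply: le_trans wg; case: (d1 w).
  exact: (connected_component_sub w1).
Qed.

Lemma stage_map_bump x : S x -> stage_map (step x).
Proof.
move=> /push_rho[_ px]; split.
- exact: bump_continuous.
- by move=> w; exact: bump_descent.
- by move=> w wg Hw; apply: (bump_component e0 _ Hg).
Qed.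

Lemma stage_map_finite s : {in s, forall x, S x} -> exists2 f, stage_map f &
  forall x w, x \in s ->
    exists2 p, descent Phi e w p & descent Phi e (step x p) (f w).
Proof.
elim: s => [_|y s IH sS]; first by exists id => //; exact: stage_map_id.
have [|f sf fP] := IH; first by move=> x xs; apply: sS; rewrite inE xs orbT.
have Sy : S y by apply: sS; rewrite inE eqxx.
exists (f \o step y); first exact: stage_map_comp (stage_map_bump Sy) sf.
move=> x w; rewrite inE => /predU1P[->|xs].
  by exists w; [exact: descent_refl|exact: stage_descent].
have [p yp pf] := fP x (step y w) xs; exists p => //.
by apply: (descent_trans e0) yp; exact: (stage_descent (stage_map_bump Sy)).
Qed.

(** The cover uses quarter balls because a bump is effective up to [rho x / 2]; the other quarter is
    left for the drift from w to p. *)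
Lemma stage_map_compact (C : set X) : compact C -> closed S ->
  exists2 f, stage_map f & forall w, C w -> S w ->
    exists x p, [/\ S x, `|w - x| < rho x / 4, descent Phi e w p &
                    descent Phi e (step x p) (f w)].
Proof.
move=> cC clS; have cCS : compact (C `&` S) by exact: compact_closedI.
have := cCS; rewrite compact_cover => /(_ X S (fun x => ball x (rho x / 4))).
case=> [x Sx|w [_ Sw]|D DS cov].
- by apply: ball_open; rewrite divr_gt0//; case: (push_rho Sx).
- by exists w => //; apply: ballxx; rewrite divr_gt0//; case: (push_rho Sw).
have DS' : {in (finmap.enum_fset D), forall x, S x}.
  by move=> x xD; have := DS x xD; rewrite inE.
have [f sf fP] := stage_map_finite DS'; exists f => // w Cw Sw.
have [x /= xD] := cov w (conj Cw Sw); rewrite -ball_normE/= distrC => wx.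
have [p wp pf] := fP x w xD; exists x, p; split => //.
by apply: DS'.
Qed.

Hypothesis S_closed : closed S.
Hypothesis S_ge : forall x, S x -> g <= Phi x.
Hypothesis rho_max : forall x r u, S x -> 0 < r <= 1 -> push Phi e x r u ->
  r <= 2 * rho x.
Hypothesis rho_le1 : forall x, S x -> rho x <= 1.

(* No trajectory of the stages stays in S: it would converge in S, and near its
   limit x the radii chosen by the stages are at least rho x / 4, so that Phi
   would decrease by a fixed amount at each late stage. *)
Lemma trajectory_leaves (x : nat -> X) :
    (forall n, descent Phi e (x n) (x n.+1)) ->
    (forall n, S (x n) -> exists z p, [/\ S z, `|x n - z| < rho z / 4,
       descent Phi e (x n) p & descent Phi e (step z p) (x n.+1)]) ->
  exists n, ~ S (x n).
Proof.
move=> dx xS; apply: contrapT => /forallNP allS.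
have {}allS n : S (x n) by apply: contrapT; exact: allS.
have gx n : g <= Phi (x n) by exact: S_ge.
have xcvg := descent_sequence_cvg e0 dx gx.
have [b b0 xb] := descent_sequence_bound e0 dx gx.
set l := limn x in xcvg.
have Sl : S l by apply: (closed_cvg _ S_closed) xcvg; exact: nearW.
have [r0 pl] := push_rho Sl.
have Phicvg : Phi (x n) @[n --> \oo] --> Phi l.
  by apply: continuous_cvg => //; exact: cPhi.
have Phidec n : Phi l <= Phi (x n).
  have Phidec : nonincreasing_seq (fun n => Phi (x n)).
    by apply/nonincreasing_seqP => m; case: (dx m).
  rewrite -(cvg_lim _ Phicvg)//; apply: nonincreasing_cvgn_ge => //.
  exact: cvgP Phicvg.
have q0 : 0 < e * (rho l / 16) by rewrite mulr_gt0// divr_gt0.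
have l0 : 0 < rho l / 16 by rewrite divr_gt0.
near \oo => n.
have xl : `|l - x n| < rho l / 16.
  by near: n; exact: cvgr_dist_lt.
have bn : b n < rho l / 16.
  near: n; move/cvgrPdist_lt: b0 => /(_ _ l0); apply: filterS => m.
  by rewrite sub0r normrN => /(le_lt_trans (ler_norm _)).
have Pn : Phi (x n) < Phi l + e * (rho l / 16).
  near: n; move/cvgrPdist_lt: Phicvg => /(_ _ q0); apply: filterS => m.
  by rewrite distrC => /(le_lt_trans (ler_norm _)); rewrite ltrBlDl.
have [z [p [Sz xz [Pp xp] [Ps _]]]] := xS n (allS n).
have [rz pz] := push_rho Sz.
(* The push at l, on a ball shrunk by |z - l|, is also a push at z, so near-maximality bounds
   [rho z] below. *)
have rhoz : rho l / 4 <= rho z.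
  have [|small] := leP (rho l) (rho z); first lra.
  have zl : `|z - l| < rho z / 4 + rho l / 16.
    have := ler_normD (z - x n) (x n - l); rewrite addrA subrK.
    by rewrite (distrC z (x n)) (distrC (x n) l); lra.
  suff : rho l - `|z - l| <= 2 * rho z by lra.
  apply: (@rho_max z (rho l - `|z - l|) (ups l)) => //.
    have := rho_le1 Sl; have := normr_ge0 (z - l).
    by move=> ? ?; apply/andP; split; lra.
  move=> w wz; have wl : `|w - l| < rho l.
    have := ler_normD (w - z) (z - l); rewrite addrA subrK; lra.
  have [uN Pw] := pl _ wl; split=> // t /andP[t0 tr]; apply: Pw.
  by rewrite t0/=; have := normr_ge0 (z - l); lra.
(* Phi at p is not below Phi at [x n.+1], so the drift to p is paid for by the decrease within one
   stage. *)
have pb : `|p - x n| <= b n.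
  apply: le_trans xp _; apply: le_trans (xb n n.+1 (leqnSn n)).
  have sp := stage_descent (stage_map_bump Sz) p.
  have k0 : 0 < 2 / e by rewrite divr_gt0.
  rewrite ler_wpM2l ?addr_ge0// lerD2r ler_expR ler_pM2l// lerD2l lerN2.
  by apply: le_trans Ps _; case: sp.
have pz2 : `|p - z| < rho z / 2.
  have := ler_normD (p - x n) (x n - z); rewrite addrA subrK; lra.
(* The bump at z would take Phi below [Phi l], against [Phidec]. *)
have := bump_decrease e0 pz pz2; rewrite -/(step z p) => dec.
have := Phidec n.+1.
have : e * (rho l / 16) <= e * (rho z / 4) by rewrite ler_pM2l//; lra.
lra.
Unshelve. all: by end_near. Qed.

End stages.

(** * Deforming a compact set off H *)

Section separation.
Context {R : realType} {X : completeNormedModType R}.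
Variables (Phi : X -> R) (e g a : R) (F : set X).
Hypotheses (cPhi : continuous Phi) (e0 : 0 < e).
Hypothesis a_small : expR (2 / e * a) - 1 < e.
Implicit Types (x y z w p : X).

Definition weighted_neighborhood := [set x | exists2 y, F y & `|x - y| < e * (1 + `|x|)].

(** The closure makes the region closed, at the price of doubling the relative distance to F
    later. *)
Definition descent_region :=
  closure weighted_neighborhood `&` [set x | g <= Phi x <= g + a].

Hypothesis region_push : forall x, descent_region x ->
  exists r u, 0 < r /\ push Phi e x r u.

Let H := F `&` superlevel Phi g.

(** The cap at 1 bounds the admissible radii, so some radius exceeds half their supremum. *)
Lemma push_near_max x : descent_region x -> exists ru : R * X,
  [/\ 0 < ru.1, ru.1 <= 1, push Phi e x ru.1 ru.2 &
      forall r u, 0 < r <= 1 -> push Phi e x r u -> r <= 2 * ru.1].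
Proof.
move=> /region_push[r [u [r0 pu]]].
pose A := [set r | 0 < r <= 1 /\ exists u, push Phi e x r u].
have A0 : A (Num.min r 1).
  split; first by rewrite lt_min r0 ltr01 ge_min lexx orbT.
  exists u => w; rewrite lt_min => /andP[wx _]; have [uN Pw] := pu _ wx.
  by split=> // t; rewrite lt_min => /and3P[t0 tr _]; apply: Pw; rewrite t0.
have supA : has_sup A.
  by split; [exists (Num.min r 1)|exists 1 => s [/andP[]]].
have sA s : A s -> s <= sup A by exact: sup_upper_bound.
have s0 : 0 < sup A.
  by apply: lt_le_trans (sA _ A0); rewrite lt_min r0 ltr01.
have [|s [/andP[s0' s1] [v pv]] ss] := @sup_adherent _ A (sup A / 2) _ supA.
  by rewrite divr_gt0.
exists (s, v); split => //= r' u' r'1 pr'.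
have /sA : A r' by split=> //; exists u'.
lra.
Qed.

Lemma closed_descent_region : closed descent_region.
Proof.
apply: closedI; first exact: closed_closure.
have -> : [set x | g <= Phi x <= g + a] =
    (Phi @^-1` [set t | g <= t]) `&` (Phi @^-1` [set t | t <= g + a]).
  by apply/seteqP; split=> x /=; [move=> /andP[]|move=> [-> ->]].
by apply: closedI; apply: closed_comp.
Qed.

(** Reaching H takes a decrease of at most a, hence by [a_small] a displacement below e (1 + |x|),
    which would put x in the weighted neighborhood of F. *)
Lemma outside_never_reaches x z : Phi x <= g + a -> ~ weighted_neighborhood x ->
  descent Phi e x z -> ~ H z.
Proof.
move=> xa xV [zx dz] [Fz /= gz]; apply: xV; exists z => //.
rewrite distrC (le_lt_trans dz)// mulrC ltr_pM2r ?ltr_pwDl//.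
apply: le_lt_trans a_small; rewrite lerD2r ler_expR ler_wpM2l//.
  by rewrite divr_ge0// ltW.
rewrite /superlevel/= in gz; lra.
Qed.

Variable K : set X.
Hypotheses (cptK : compact K) (K_le : forall x, K x -> Phi x <= g + a).

(** Every trajectory enters at some stage an open set from which H is never reached again;
    neighbouring trajectories enter it at the same stage, and compactness of K gives a common number
    of stages. *)
Lemma deformation : exists2 f, stage_map Phi e g H f & forall x, K x -> ~ H (f x).
Proof.
have /choice[ru ruP] : forall x, exists q : R * X, descent_region x ->
    [/\ 0 < q.1, q.1 <= 1, push Phi e x q.1 q.2 &
      forall r u, 0 < r <= 1 -> push Phi e x r u -> r <= 2 * q.1].
  move=> x; have [/push_near_max[q qP]|nx] := pselect (descent_region x).
    by exists q.
  by exists (0, 0) => /nx.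
pose rho x := (ru x).1; pose ups x := (ru x).2.
have Hg x : H x -> g <= Phi x by case.
have push_rho x : descent_region x -> 0 < rho x /\ push Phi e x (rho x) (ups x).
  by move=> /ruP[].
(* Stages are chosen for all sets C, the identity for noncompact ones, so that [eta] can be defined
   before its images of K are known to be compact. *)
have /choice[beta betaP] : forall C, exists f : X -> X,
    stage_map Phi e g H f /\
    (compact C -> forall w, C w -> descent_region w -> exists x p,
      [/\ descent_region x, `|w - x| < rho x / 4, descent Phi e w p &
          descent Phi e (bump x (rho x) (ups x) p) (f w)]).
  move=> C.
  have [cC|ncC] := pselect (compact C); last first.
    by exists id; split=> //; exact: stage_map_id.
  have [f sf fP] := stage_map_compact e0 Hg push_rho cC closed_descent_region.
  by exists f.
pose eta := fix eta n := if n is m.+1 then beta (eta m @` K) \o eta m else id.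
have eta_stage n : stage_map Phi e g H (eta n).
  elim: n => [|n IH]; first exact: stage_map_id.
  exact: stage_map_comp IH (betaP _).1.
have eta_step n x : descent Phi e (eta n x) (eta n.+1 x).
  exact: stage_descent (betaP _).1 _.
have eta_descent n m x : (n <= m)%N -> descent Phi e (eta n x) (eta m x).
  exact: (descent_sequence e0 (eta_step^~ x)).
have eta_compact n : compact (eta n @` K).
  apply: continuous_compact => //; apply: continuous_subspaceT.
  exact: stage_continuous (eta_stage n).
suff : \forall n \near \oo, K `<=` [set x | ~ H (eta n x)].
  by move=> [n _ /(_ n (leqnn n)) nP]; exists (eta n).
move/compact_near_coveringP/near_covering_withinP: cptK => /(_ nat \oo).
apply=> x Kx.
have Ka n y : K y -> Phi (eta n y) <= g + a.
  by move=> /K_le; apply: le_trans; case: (eta_descent 0%N n y (leq0n n)).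
have [n nS] : exists n, ~ descent_region (eta n x).
  apply: (trajectory_leaves cPhi e0 Hg push_rho closed_descent_region
    _ _ _ (x := fun n => eta n x)).
  - by move=> y [_ /= /andP[]].
  - by move=> y r u /ruP[_ _ _]; apply.
  - by move=> y /ruP[].
  - by move=> n; exact: eta_step.
  - move=> n Sn; apply: (betaP (eta n @` K)).2 => //.
pose U := [set w | Phi w < g] `|` ~` closure weighted_neighborhood.
have oU : open U.
  apply: openU; last exact/closed_openC/closed_closure.
  by apply: (@open_comp _ _ Phi [set t | t < g]) => //; exact: open_lt.
have Ux : U (eta n x).
  have [Phig|gPhi] := ltP (Phi (eta n x)) g; [by left|right => clV].
  by apply: nS; split=> //=; rewrite gPhi Ka.
near=> y m => Ky /= Hm.
have nm : (n <= m)%N by near: m; exact: nbhs_infty_ge.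
have : U (eta n y).
  near: y; apply: (stage_continuous (eta_stage n)).
  exact: open_nbhs_nbhs.
move=> [/= yg|yV].
  have [le_m _] := eta_descent n m y nm.
  by have := Hg _ Hm; rewrite leNgt (le_lt_trans le_m).
apply: outside_never_reaches (Ka n y Ky) _ (eta_descent n m y nm) Hm.
by move=> ?; apply: yV; exact: subset_closure.
Unshelve. all: by end_near. Qed.

(** The connection runs from z0 to f z0, within the image of K to f z1, and back to z1, all off
    H. *)
Lemma same_component z0 z1 : connected K -> K z0 -> K z1 ->
    Phi z0 <= g -> Phi z1 <= g -> ~ H z0 -> ~ H z1 ->
  connected_component (~` H) z0 = connected_component (~` H) z1.
Proof.
move=> coK K0 K1 g0 g1 H0 H1; have [f [cf _ mf] fK] := deformation.
apply: same_connected_component.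
apply: connected_component_trans (mf _ g0 H0) _.
apply: connected_component_trans (connected_component_sym (mf _ g1 H1)).
apply: (@connected_component_max _ _ (f @` K)).
- by exists z0.
- by move=> _ [x Kx <-]; exact: fK.
- by apply: connected_continuous_connected => //; exact: continuous_subspaceT.
- by exists z1.
Qed.

End separation.

(** * Almost critical points *)

Section almost_critical_points.
Context {R : realType} {X : completeNormedModType R}.
Variable Phi : X -> R.
Hypothesis hPhi : locally_lipschitz Phi.
Implicit Types (x y z v w : X) (e : R) (F : set X).

Let cPhi : continuous Phi := locally_lipschitz_continuous hPhi.

Lemma minimax_values_neq0 z0 z1 :
  [set m | exists2 c, paths z0 z1 c &
     is_maximum [set Phi (c t) | t in `[0, 1]] m] !=set0.
Proof.
have [|t t01 tmax] := @EVT_max R (Phi \o segment z0 z1) 0 1 ler01.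
  apply: continuous_subspaceT => t; apply: continuous_comp.
    exact: continuous_segment.
  exact: cPhi.
exists (Phi (segment z0 z1 t)), (segment z0 z1).
  split; first exact/continuous_subspaceT/continuous_segment.
    by rewrite /segment scale0r addr0.
  by rewrite /segment scale1r addrC subrK.
by split; [exists t|move=> _ [s s01 <-]; exact: tmax].
Qed.

Lemma minimax_values_lbound z0 z1 : lbound
  [set m | exists2 c, paths z0 z1 c &
     is_maximum [set Phi (c t) | t in `[0, 1]] m] (Num.max (Phi z0) (Phi z1)).
Proof.
move=> m [c [_ c0 c1] [_ cm]]; rewrite ge_max; apply/andP; split.
- by apply: cm; exists 0; rewrite ?c0//= in_itv/= lexx ler01.
- by apply: cm; exists 1; rewrite ?c1//= in_itv/= lexx ler01.
Qed.

Lemma minimax_level_ge z0 z1 :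
  Num.max (Phi z0) (Phi z1) <= minimax_level Phi z0 z1.
Proof.
apply: lb_le_inf; [exact: minimax_values_neq0|exact: minimax_values_lbound].
Qed.

(** The push direction (1 + |x|) v turns a slope below - e / (1 + |x|) into decrease at rate e. *)
Lemma negative_clarke_push x v e : 0 < e -> `|v| <= 1 ->
    (clarke_derivative Phi x v < (- (e / (1 + `|x|)))%:E)%E ->
  exists r u, 0 < r /\ push Phi e x r u.
Proof.
move=> e0 v1; have N0 : 0 < 1 + `|x| by rewrite ltr_pwDl.
rewrite clarke_derivativeE// lte_fin -subr_gt0 => d0.
have [s [r r0 sP]] := inf_adherent d0 (has_inf_upper_slopes hPhi x v).
rewrite addrC subrK => slt.
have sN : s * (1 + `|x|) <= - e by rewrite -ler_pdivlMr// mulNr ltW.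
(* Radius 1/2 gives 1 + |x| <= 2 (1 + |w|); the other bound keeps w near x and the rescaled time t
   (1 + |x|) below r. *)
exists (Num.min (r / (1 + `|x|)) (1 / 2)), ((1 + `|x|) *: v); split.
  by rewrite lt_min !divr_gt0.
move=> w; rewrite lt_min => /andP[wr w2]; split.
  rewrite normrZ gtr0_norm//; apply: le_trans (_ : 1 + `|x| <= _).
    by rewrite ler_piMr// ltW.
  by have := normr_ge0 w; have := ler_normD (x - w) w; rewrite subrK distrC; lra.
move=> t; rewrite lt_min => /and3P[+ tr _].
rewrite le_eqVlt => /predU1P[<-|t0].
  by rewrite scale0r addr0 mul0r subr0.
rewrite ltr_pdivlMr// in tr.
have wr' : `|w - x| < r.
  by apply: lt_le_trans wr _; rewrite ler_pdivrMr// ler_peMr ?(ltW r0)// lerDl.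
have := sP w (t * (1 + `|x|)) wr'; rewrite mulr_gt0//= scalerA => /(_ tr).
by have := ler_wpM2l (ltW t0) sN; lra.
Qed.

Lemma closure_weighted_neighborhood F e x : 0 < e <= 1 ->
  closure (weighted_neighborhood e F) x ->
  exists2 y, F y & `|x - y| <= 2 * e * (1 + `|x|).
Proof.
move=> /andP[e0 e1] clx.
(* Passing from x to w costs e / 2 in distance and, as e <= 1, at most e / 2 more through the
   weight. *)
have [|w [[y Fy wy]]] := clx (ball x (e / 2)).
  by apply: nbhsx_ballx; rewrite divr_gt0.
rewrite -ball_normE/= => xw; exists y => //.
have := ler_normD (x - w) (w - y); rewrite addrA subrK.
have := ler_wpM2l (ltW e0) (ler_normD (w - x) x); rewrite subrK (distrC w x).
have := normr_ge0 x; have : e * `|x - w| <= 1 * `|x - w| by rewrite ler_wpM2r.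
have := mulr_ge0 (ltW e0) (normr_ge0 x); lra.
Qed.

Lemma exists_small_exponent e : 0 < e ->
  exists a, [/\ 0 < a, a <= e & expR (2 / e * a) - 1 < e].
Proof.
move=> e0; have k0 : 0 < 2 / e by rewrite divr_gt0.
have l0 : 0 < ln (1 + e / 2) by rewrite ln_gt0// ltrDl divr_gt0.
(* Aiming at e / 2 makes the last inequality strict. *)
exists (Num.min e (ln (1 + e / 2) / (2 / e))); split.
- by rewrite lt_min e0 divr_gt0.
- by rewrite ge_min lexx.
- apply: le_lt_trans (_ : e / 2 < e); last by rewrite ltr_pdivrMr// ltr_pMr// ltrDl.
  rewrite lerBlDl -[leRHS]lnK; last by rewrite posrE ltr_pwDl// divr_ge0// ltW.
  by rewrite ler_expR -ler_pdivlMl// mulrC ge_min lexx orbT.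
Qed.

(** Otherwise every point of the region has a push, and the image of a path with maximum below g +
    a, taken as K, shows that z0 and z1 share a component. *)
Lemma almost_critical_point z0 z1 F e : closed F -> 0 < e <= 1 ->
    separates (F `&` superlevel Phi (minimax_level Phi z0 z1)) z0 z1 ->
  exists x, [/\ exists2 y, F y & `|x - y| <= 2 * e * (1 + `|x|),
    minimax_level Phi z0 z1 <= Phi x <= minimax_level Phi z0 z1 + e &
    forall v, `|v| <= 1 ->
      ((- (e / (1 + `|x|)))%:E <= clarke_derivative Phi x v)%E].
Proof.
move=> clF /andP[e0 e1] [clH H0 H1 sep]; apply: contrapT => noncrit; apply: sep.
have [a [a0 ae asmall]] := exists_small_exponent e0.
set g := minimax_level Phi z0 z1 in clH H0 H1 noncrit *.
have /andP[g0 g1] : (Phi z0 <= g) && (Phi z1 <= g).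
  by rewrite -ge_max; exact: minimax_level_ge.
have [m [c [cc c0 c1] [_ cmax]] mg] := inf_adherent a0
  (conj (minimax_values_neq0 z0 z1) (ex_intro _ _ (@minimax_values_lbound z0 z1))).
apply: (@same_component _ _ _ e g a F cPhi e0 asmall _ (c @` `[0, 1])) => //.
- move=> x [clx /andP[gx xa]]; apply: contrapT => nopush; apply: noncrit.
  exists x; split.
  + by apply: closure_weighted_neighborhood => //; rewrite e0.
  + by rewrite gx (le_trans xa)// lerD2l.
  + move=> v v1; rewrite leNgt; apply/negP => /(negative_clarke_push e0 v1).
    exact: nopush.
- by apply: continuous_compact => //; exact: segment_compact.
- by move=> _ [t t01 <-]; apply: (le_trans _ (ltW mg)); apply: cmax; exists t.
- by apply: connected_continuous_connected => //; exact: segment_connected.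
- by exists 0; rewrite //= in_itv/= lexx ler01.
- by exists 1; rewrite //= in_itv/= lexx ler01.
Qed.

End almost_critical_points.

Theorem theorem1p8 (R : realType) (X : completeNormedModType R)
    (Phi : X -> R) (hPhi : locally_lipschitz Phi) (z0 z1 : X) (F : set X)
    (hF : closed F)
    (hsep : separates (F `&` superlevel Phi (minimax_level Phi z0 z1)) z0 z1) :
  exists (x : nat -> X) (m : nat -> R),
    [/\ dist_delta (x n) F @[n --> \oo] --> (0 : R),
        Phi (x n) @[n --> \oo] --> minimax_level Phi z0 z1,
        forall n, is_minimum [set dual_norm y | y in clarke_gradient Phi (x n)]
                    (m n) &
        (1 + `|x n|) * m n @[n --> \oo] --> (0 : R)].
Proof.
set g := minimax_level Phi z0 z1.
have /choice[xm xmP] n : exists q : X * R,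
    [/\ 0 <= dist_delta q.1 F <= harmonic n, g <= Phi q.1 <= g + harmonic n,
        is_minimum [set dual_norm y | y in clarke_gradient Phi q.1] q.2 &
        0 <= (1 + `|q.1|) * q.2 <= harmonic n].
  have h1 : harmonic n <= 1 :> R by rewrite invf_le1 ?ler1n.
  have h0 : 0 < harmonic n :> R by exact: harmonic_gt0.
  move: (harmonic n) h0 h1 => h h0 h1.
  (* With e = h / 4, the relative distance 2 e is at most 1/2, as [dist_delta_le] demands, and the
     resulting bound 2 (2 e) is h. *)
  have e01 : 0 < h / 4 <= 1 by apply/andP; split; lra.
  have [x [[y Fy xy] /andP[gx xg] xcrit]] :=
    almost_critical_point hPhi hF e01 hsep.
  have [m /andP[m0 me] mmin] := clarke_gradient_least_norm hPhi xcrit.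
  have N0 : 0 < 1 + `|x| by rewrite ltr_pwDl.
  exists (x, m); split => //=; apply/andP; split.
  - by apply: dist_delta_ge0; exists y.
  - have e12 : 2 * (h / 4) <= 1 / 2 by lra.
    by have := dist_delta_le Fy e12 xy; lra.
  - exact: gx.
  - by apply: le_trans xg _; rewrite lerD2l; lra.
  - by rewrite mulr_ge0// ltW.
  - by move: me; rewrite ler_pdivlMr// mulrC; lra.
exists (fun n => (xm n).1), (fun n => (xm n).2).
split; last 2 first.
- by move=> n; case: (xmP n).
- apply: (squeeze_cvgr _ (cvg_cst 0) cvg_harmonic).
  by apply: nearW => n; case: (xmP n).
- apply: (squeeze_cvgr _ (cvg_cst 0) cvg_harmonic).
  by apply: nearW => n; case: (xmP n).
- apply: (squeeze_cvgr _ (cvg_cst g)); last first.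
    by rewrite -[X in _ --> X]addr0; apply: cvgD; [exact: cvg_cst|exact: cvg_harmonic].
  by apply: nearW => n; case: (xmP n).
Qed.
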